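(* Redundant shares can be introduced to the scheme of Shamir by distributing the same share multiple times to different shareholders. Precisely: let $p$ be a prime, let $1\le t\le m<p$, and let $x_1,\dots,x_m\in GF(p)$ be public, pairwise distinct and nonzero. Consider Shamir's scheme with threshold $t$ in which the points $(x_i,f(x_i))$, $1\le i\le m$, are distributed to $n\ge m$ shareholders, each shareholder receiving one point, each point being distributed at least once and some points possibly being distributed to several different shareholders. If two different shareholders receive the same point, then their two shares are redundant: no set $\mathcal{A}'$ of exactly $t$ shares that contains both of these shares can compute the secret $S$.
   Context: $GF(p)$ is the field with $p$ elements. Shamir's scheme with threshold $t$: for a secret $S\in GF(p)$ the dealer draws $a_1,\dots,a_{t-1}$ independently and uniformly from $GF(p)$ and forms $f(x)=S+a_1x+\cdots+a_{t-1}x^{t-1}$ over $GF(p)$; shares are evaluations $f(x_i)$ at public points $x_i$. Shares held by different shareholders are counted as different elements of a set of shares, even if they have the same value (so a set of $t$ shares means the shares of $t$ different shareholders). A set of shares ''can compute $S$'' if there is a function of the values of these shares (and the public data) which returns $S$ for every secret and all possible values of the dealer's random choices. Two shares $R$ and $Q$ in a $(t,n)$-secret sharing scheme (threshold $t$, $n$ shares) are called redundant if there exists no set $\mathcal{A}'$ of shares with $R,Q\in\mathcal{A}'$ and $|\mathcal{A}'|=t$ which can compute $S$. *)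

(* Defs.v *)
From mathcomp Require Import all_boot all_algebra.

Set Implicit Arguments.
Unset Strict Implicit.
Unset Printing Implicit Defensive.

Import GRing.Theory.
Local Open Scope ring_scope.

Section SecretSharing.

(* A scheme is given by its dealing function: [share S r i] is the value that
   shareholder [i] receives when the secret is [S] and the dealer's random
   choices are [r]; the public data are fixed parameters of [share]. Shares are
   identified with their shareholders, so that shares of different
   shareholders are different even when their values agree. *)
Variables (secret rand value : Type) (I : finType).
Variable share : secret -> rand -> I -> value.

Definition can_compute (A : {set I}) : Prop :=
  exists g : {ffun {i : I | i \in A} -> value} -> secret,
    forall (S : secret) (r : rand), g [ffun i => share S r (val i)] = S.

Definition redundant (t : nat) (R Q : I) : Prop :=
  ~ exists A : {set I}, [/\ R \in A, Q \in A, #|A| = t & can_compute A].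

End SecretSharing.

(* The coefficient of degree i.+1 is [a i]; all of {ffun 'I_t.-1 -> F} is the
   support of the dealer's independent uniform choices. Meaningful for t > 0. *)
Definition shamir_poly (F : finFieldType) (t : nat) (S : F)
    (a : {ffun 'I_t.-1 -> F}) : {poly F} :=
  S%:P + \sum_(i < t.-1) a i *: 'X^(i.+1).

Definition shamir_share (F : finFieldType) (t m n : nat) (x : 'I_m -> F)
    (d : 'I_n -> 'I_m) (S : F) (a : {ffun 'I_t.-1 -> F}) (j : 'I_n) : F * F :=
  (x (d j), (shamir_poly S a).[x (d j)]).

(* Main.v *)
(** Two shares at the same point leave at most [t - 1] distinct points among
    the [t] shares. The monic polynomial [q] with roots exactly at these points
    has degree at most [t - 1], so it is a possible choice of the dealer, for the
    secret [q(0)]. It gives these shareholders the same shares as the zero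
    polynomial does, but [q(0) != 0] because all points are nonzero. *)

Require Import Defs.
From mathcomp Require Import all_boot all_algebra.

Set Implicit Arguments.
Unset Strict Implicit.
Unset Printing Implicit Defensive.

Import GRing.Theory.
Local Open Scope ring_scope.

(** Lets any polynomial of degree below [t] serve as a choice of the dealer. *)
Lemma shamir_poly_coef (F : finFieldType) (t : nat) (q : {poly F}) :
  (0 < t)%N -> (size q <= t)%N ->
  shamir_poly q`_0 [ffun i : 'I_t.-1 => q`_i.+1] = q.
Proof.
case: t => // t _ le_qt.
have q_def : q = \poly_(i < t.+1) q`_i.
  apply/polyP => i; rewrite coef_poly; case: ltnP => // le_ti.
  by rewrite nth_default // (leq_trans le_qt).
rewrite /shamir_poly [RHS]q_def poly_def big_ord_recl expr0 alg_polyC.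
by congr (_ + _); apply: eq_bigr => i _; rewrite ffunE.
Qed.

(** The recovering function [g] gets the same input from both dealings. *)
Lemma can_compute_inj (secret rand value : Type) (I : finType)
    (share : secret -> rand -> I -> value) (A : {set I}) S r S' r' :
  can_compute share A -> {in A, share S r =1 share S' r'} -> S = S'.
Proof.
case=> g gP eq_sh; rewrite -(gP S r) -(gP S' r'); congr (g _).
by apply/ffunP => i; rewrite !ffunE eq_sh // (valP i).
Qed.

Lemma card_imset_lt (aT rT : finType) (f : aT -> rT) (A : {set aT}) a b :
  a \in A -> b \in A -> a != b -> f a = f b -> (#|f @: A| < #|A|)%N.
Proof.
move=> Aa Ab neq_ab eq_f; rewrite ltn_neqAle leq_imset_card andbT.
by apply: contraNneq neq_ab => /eqP/imset_injP injf; rewrite (injf a b).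
Qed.

Theorem lemma6 (p t m n : nat) (p_prime : prime p)
    (t_gt0 : (1 <= t)%N) (le_tm : (t <= m)%N) (lt_mp : (m < p)%N)
    (le_mn : (m <= n)%N)
    (x : 'I_m -> 'F_p) (x_inj : injective x) (x_neq0 : forall i, x i != 0)
    (d : 'I_n -> 'I_m) (d_surj : forall i : 'I_m, exists j : 'I_n, d j = i)
    (R Q : 'I_n) (neq_RQ : R != Q) (same_point : d R = d Q) :
  redundant (shamir_share (t := t) x d) t R Q.
Proof.
case=> A [AR AQ cardA compA].
pose q := \prod_(i in d @: A) ('X - (x i)%:P).
have size_q : (size q <= t)%N.
  (* The size of [q] is one more than the number of points, so the strict bound on [d @: A] is just
     enough. *)
  by rewrite /q -big_enum size_prod_XsubC -cardE -cardA (card_imset_lt AR AQ).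
have q0 : q`_0 != 0.
  rewrite -horner_coef0 horner_prod prodf_seq_neq0.
  by apply/allP => i _; rewrite hornerXsubC sub0r oppr_eq0 x_neq0 implybT.
have zero_poly : shamir_poly 0 [ffun _ : 'I_t.-1 => 0] = 0 :> {poly 'F_p}.
  by rewrite /shamir_poly big1 ?addr0 // => i _; rewrite ffunE scale0r.
case/eqP: q0.
apply: (can_compute_inj (r := [ffun i : 'I_t.-1 => q`_i.+1])
                        (r' := [ffun=> 0]) compA) => j Aj.
rewrite /shamir_share shamir_poly_coef // zero_poly horner0; congr (_, _).
(* The factor of [q] for the point [d j] vanishes there. *)
by rewrite horner_prod (bigD1 (d j)) ?imset_f //= hornerXsubC subrr mul0r.
Qed.
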